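(* For every $p\in(0,1)$ there is a constant $c>0$ such that, with probability tending to $1$ as $n\to\infty$, every $C_4$-free subgraph of the random graph $G(n,p)$ has at most $(1/2-c)n^{3/2}$ edges. In particular, for $p=1/2$ one can take $c=0.028$.
   Context: $G(n,p)$ denotes the binomial random graph on vertex set $[n]$ in which each pair is an edge independently with probability $p$. A graph is $C_4$-free if it contains no cycle of length $4$ as a (not necessarily induced) subgraph. *)

(* Defs.v *)
From HB Require Import structures.
From mathcomp Require Import all_boot all_order all_algebra.
From mathcomp Require Import all_classical all_reals all_analysis.

Set Implicit Arguments.
Unset Strict Implicit.
Unset Printing Implicit Defensive.

Import Order.TTheory GRing.Theory Num.Theory.
Import numFieldNormedType.Exports.

Local Open Scope ring_scope.

Definition pairs (n : nat) : {set {set 'I_n}} := [set e : {set 'I_n} | #|e| == 2%N].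

(* Simple graphs with vertex set 'I_n, given by their edge sets. *)
Record sgraph (n : nat) := SGraph {
  edges :> {set {set 'I_n}};
  edges_pairs : edges \subset pairs n
}.

HB.instance Definition _ (n : nat) := [isSub for @edges n].
HB.instance Definition _ (n : nat) := [Finite of sgraph n by <:].

Definition adj (n : nat) (G : sgraph n) : rel 'I_n :=
  fun x y => [set x; y] \in edges G.

(* Only subgraphs on the full vertex set are considered: discarding isolated
   vertices changes neither the number of edges nor the cycles. *)
Definition subgraph (n : nat) (H G : sgraph n) : bool := edges H \subset edges G.

Definition C4_free (n : nat) (G : sgraph n) : bool :=
  ~~ [exists s : 4.-tuple 'I_n, ucycleb (adj G) s].

(* The mass of G under the product of Bernoulli(p) laws over all pairs. *)
Definition Gnp_weight (R : realType) (n : nat) (p : R) (G : sgraph n) : R :=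
  \prod_(e in pairs n) (if e \in edges G then p else 1 - p).

Definition Gnp_prob (R : realType) (n : nat) (p : R) (A : pred (sgraph n)) : R :=
  \sum_(G | A G) Gnp_weight p G.

Definition C4_free_subgraphs_bounded (R : realType) (c : R) (n : nat)
    (G : sgraph n) : bool :=
  [forall H : sgraph n, (subgraph H G && C4_free H) ==>
     (#|edges H|%:R <= (1 / 2 - c) * n%:R `^ (3 / 2))].

Lemma Gnp_prob_total (R : realType) (n : nat) (p : R) :
  Gnp_prob p (fun _ : sgraph n => true) = 1.
Proof.
rewrite /Gnp_prob /Gnp_weight.
transitivity (\prod_(e : {set 'I_n}) ((if e \in pairs n then p else 0) +
     (if e \in pairs n then 1 - p else 1))).
  rewrite bigA_distr.
  rewrite (bigID (fun J : {set {set 'I_n}} => J \subset pairs n)) /= [X in _ = _ + X]big1 ?addr0; last first.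
    move=> J /subsetPn[e eJ ne]; rewrite (bigD1 e) //= eJ (negbTE ne) mul0r //.
  rewrite (reindex_omap (@edges n) insub) /=; last first.
    by move=> J JP; rewrite insubT.
  apply: eq_big => [G|G _]; first by rewrite (edges_pairs G) valK eqxx.
  rewrite big_mkcond; apply: eq_bigr => e _.
  by case: ifP => // ep; case: ifP => // eG; move: (fintype.subsetP (edges_pairs G) e eG); rewrite ep.
by rewrite big1 // => e _; case: ifP; rewrite ?add0r // addrC subrK.
Qed.

(* Main.v *)
(* In a C4-free graph [H] two vertices have at most one common neighbour, so the
   degrees satisfy [sum_v d(v)^2 <= 2 n^2].  Take a random sample [S] of about
   [n / k] vertices, [k] a small power of [n].  The edges of [H] meeting [S] are
   so few that all possibilities for them, and for the degree sequence, can be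
   listed at a cost of [exp(o(n^(3/2)))].  They determine the graph [J] joining
   vertices with a common neighbour in [S]; for [v] outside [S] the neighbourhood
   of [v] is independent in [J], because [H] is C4-free.  By Cauchy-Schwarz every
   set of degree sum above [(1 + o(1)) n] spans many edges of [J], so the
   Kleitman-Winston algorithm puts the neighbourhood of [v] in one of
   [exp(n^(1/2-c'))] containers of degree sum at most [(1 + o(1)) n].

   Weight the pair [vw] by [d(w)] if [w] lies in the container of [v], plus [d(v)]
   if [v] lies in the container of [w] (degrees being capped at [L sqrt n]).  The
   total weight is at most [(1 + o(1)) n^2], so by Chernoff and a union bound over
   the [exp(o(n^(3/2)))] weights, the weight of G(n,p) is at most
   [(p + o(1)) n^2].  But [H] has weight about [sum_v d(v)^2 >= (2 e(H))^2 / n],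
   so [e(H) <= (sqrt p / 2 + o(1)) n^(3/2)] whenever [H] is contained in G(n,p). *)

Require Import Defs.
From mathcomp Require Import all_boot all_order all_algebra.
From mathcomp Require Import all_classical all_reals all_analysis.
From mathcomp Require Import ring lra.
Import Order.TTheory GRing.Theory Num.Theory.
Import numFieldNormedType.Exports.

Set Implicit Arguments.
Unset Strict Implicit.
Unset Printing Implicit Defensive.

Local Open Scope ring_scope.

(** * Random graphs *)

Lemma sgraph_distr (R : comPzRingType) (n : nat) (a b : {set 'I_n} -> R) :
  \sum_(G : sgraph n) \prod_(e in pairs n) (if e \in edges G then a e else b e)
  = \prod_(e in pairs n) (a e + b e).
Proof.
rewrite [RHS]big_mkcond /=.
(* Non-pairs get the factor [0 + 1], so only subsets of [pairs n] survive the expansion. *)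
transitivity (\prod_(e : {set 'I_n}) ((if e \in pairs n then a e else 0) +
     (if e \in pairs n then b e else 1))); last first.
  by apply: eq_bigr => e _; case: ifP => // _; rewrite add0r.
rewrite bigA_distr.
rewrite [RHS](bigID (fun J : {set {set 'I_n}} => J \subset pairs n)) /=.
rewrite [X in _ = _ + X]big1 ?addr0; last first.
  by move=> J /subsetPn[e eJ ne]; rewrite (bigD1 e) //= eJ (negbTE ne) mul0r.
rewrite [RHS](reindex_omap (@edges n) insub) /=; last first.
  by move=> J JP; rewrite insubT.
apply: eq_big => [G|G _]; first by rewrite (edges_pairs G) valK eqxx.
rewrite big_mkcond; apply: eq_bigr => e _.
by case: ifP => // ep; case: ifP => // /(fintype.subsetP (edges_pairs G)); rewrite ep.
Qed.

(** From [1 - x <= expR (- x)] one gets [(1 - x) * expR x <= 1], while [(1 - x) * (1 + x + 2 * x ^+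
    2) = 1 + x ^+ 2 - 2 * x ^+ 3] is at least 1 up to [x = 1 / 2]. *)
Lemma expR_le_quadratic (R : realType) (x : R) :
  0 <= x -> x <= 1 / 2 -> expR x <= 1 + x + 2 * x ^+ 2.
Proof.
move=> x0 x1; have := @expR_ge1Dx R (- x).
have e0 := expR_gt0 x; rewrite expRN => h.
have h2 : (1 - x) * expR x <= 1.
  by rewrite -[leRHS](mulVf (lt0r_neq0 e0)) ler_wpM2r // ltW.
have : (1 - x) * expR x <= (1 - x) * (1 + x + 2 * x ^+ 2).
  by apply: (le_trans h2); nra.
by rewrite ler_pM2l //; lra.
Qed.

Section GnpProbability.
Variables (R : realType) (n : nat) (p : R).
Hypotheses (p0 : 0 <= p) (p1 : p <= 1).

Lemma Gnp_weight_ge0 (G : sgraph n) : 0 <= Gnp_weight p G.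
Proof. by apply: prodr_ge0 => e _; case: ifP => // _; rewrite subr_ge0. Qed.

Lemma Gnp_prob_ge0 (A : pred (sgraph n)) : 0 <= Gnp_prob p A.
Proof. by apply: sumr_ge0 => G _; exact: Gnp_weight_ge0. Qed.

Lemma Gnp_probC (A : pred (sgraph n)) :
  Gnp_prob p A = 1 - Gnp_prob p (fun G => ~~ A G).
Proof.
apply/eqP; rewrite eq_sym subr_eq -(Gnp_prob_total n p) /Gnp_prob.
by rewrite [X in X == _](bigID A).
Qed.

Lemma Gnp_prob_union (I : finType) (A : pred (sgraph n)) (B : I -> pred (sgraph n)) :
  (forall G, A G -> exists i, B i G) ->
  Gnp_prob p A <= \sum_i Gnp_prob p (B i).
Proof.
move=> AB; rewrite /Gnp_prob.
under [leRHS]eq_bigr do rewrite big_mkcond.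
rewrite exchange_big big_mkcond; apply: ler_sum => G _ /=.
have pos i : 0 <= (if B i G then Gnp_weight p G else 0).
  by case: ifP => // _; exact: Gnp_weight_ge0.
case: ifPn => [/AB[i Bi]|_]; last exact: sumr_ge0.
by rewrite (bigD1 i) //= Bi lerDl; apply: sumr_ge0.
Qed.

(** Exponential Markov inequality. As [w e <= K], the quadratic term of [expR (lam * w e)] is
    absorbed into the linear one, at the cost of the factor [1 + 2 * (lam * K)] on the mean. *)
Lemma Gnp_prob_chernoff (w : {set 'I_n} -> R) (K lam t : R) :
  (forall e, e \in pairs n -> 0 <= w e <= K) -> 0 < lam -> lam * K <= 1 / 2 ->
  Gnp_prob p (fun G => t <= \sum_(e in edges G) w e) <=
  expR (lam * (p * (1 + 2 * (lam * K)) * (\sum_(e in pairs n) w e) - t)).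
Proof.
move=> wK lam0 lamK.
have -> : lam * (p * (1 + 2 * (lam * K)) * (\sum_(e in pairs n) w e) - t) =
    \sum_(e in pairs n) lam * (p * (1 + 2 * (lam * K)) * w e) - lam * t.
  by rewrite -!mulr_sumr; ring.
rewrite expRD expR_sum.
apply: (@le_trans _ _ ((\sum_(G : sgraph n) Gnp_weight p G *
    expR (lam * \sum_(e in edges G) w e)) * expR (- (lam * t)))).
  rewrite mulr_suml /Gnp_prob big_mkcond; apply: ler_sum => G _.
  have W0 := Gnp_weight_ge0 G.
  case: ifP => [tG|_]; last by rewrite !mulr_ge0 ?expR_ge0.
  rewrite -mulrA -expRD -[leLHS]mulr1 ler_wpM2l //.
  by rewrite -[leLHS]expR0 ler_expR subr_ge0 ler_pM2l.
rewrite ler_wpM2r ?expR_ge0 //.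
(* Independence: the moment generating function is a product over pairs. *)
have -> : \sum_(G : sgraph n) Gnp_weight p G *
      expR (lam * \sum_(e in edges G) w e) =
    \prod_(e in pairs n) (p * expR (lam * w e) + (1 - p)).
  rewrite -sgraph_distr; apply: eq_bigr => G _.
  rewrite mulr_sumr expR_sum.
  have -> : \prod_(e in edges G) expR (lam * w e) =
      \prod_(e in pairs n) (if e \in edges G then expR (lam * w e) else 1).
    rewrite -big_mkcondr; apply: eq_bigl => e.
    by case eG: (e \in edges G); rewrite ?andbT ?andbF // (fintype.subsetP (edges_pairs G)).
  by rewrite -big_split; apply: eq_bigr => e _; case: ifP => _ //=; rewrite mulr1.
apply: ler_prod => e /wK /andP[w0 wk]; apply/andP; split.
  by rewrite addr_ge0 ?subr_ge0 // mulr_ge0 ?expR_ge0.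
have lw0 : 0 <= lam * w e by rewrite mulr_ge0 // ltW.
have lwK : lam * w e <= lam * K by rewrite ler_wpM2l // ltW.
have := expR_le_quadratic lw0 (le_trans lwK lamK) => hq.
apply: (le_trans _ (expR_ge1Dx _)).
have -> : lam * (p * (1 + 2 * (lam * K)) * w e) =
  p * (lam * w e + 2 * (lam * w e * (lam * K))) by ring.
have : p * expR (lam * w e) <= p * (1 + lam * w e + 2 * (lam * w e) ^+ 2).
  by rewrite ler_wpM2l.
have : p * (lam * w e) ^+ 2 <= p * (lam * w e * (lam * K)).
  by rewrite ler_wpM2l // expr2 ler_wpM2l.
nra.
Qed.

End GnpProbability.

(** * Containers for independent sets *)

(* The Kleitman-Winston algorithm, as a recursion: query a vertex [x] of large
   degree in [U]; if it is outside [I] delete it, and if it is in [I] record it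
   and delete its neighbours too, which shrinks [U] by the factor [1 - rho]. *)
Lemma light_containers (R : realFieldType) (T : finType) (J : rel T) (F : T -> R)
    (B theta rho : R) (U : {set T}) :
  (forall x, 0 <= F x <= B) -> 0 <= B -> 0 <= theta -> rho <= 1 ->
  (forall W : {set T}, W \subset U -> theta < \sum_(x in W) F x ->
     exists2 x, x \in W & rho * #|W|%:R <= #|[set y in W | J x y]|%:R) ->
  exists dec : {set T} -> {set T},
    (forall A, \sum_(x in dec A) F x <= theta + B * #|A|%:R) /\
    (forall I : {set T}, I \subset U -> {in I &, forall x y, ~~ J x y} ->
       exists A : {set T}, [/\ A \subset I, I \subset dec A &
         forall l : nat, #|U|%:R * (1 - rho) ^+ l < 1 -> (#|A| <= l)%N]).
Proof.
move=> FB B0 theta0 rho1.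
have [m] := ubnP #|U|; elim: m U => // m IHm U Um hU.
have [light|heavy] := lerP (\sum_(x in U) F x) theta.
  exists (fun=> U); split=> [A|I IU _].
    by rewrite (le_trans light) // lerDl mulr_ge0.
  by exists finset.set0; split; rewrite ?finset.sub0set // => l _; rewrite cards0.
have [x xU deg] := hU U (fintype.subxx _) heavy.
pose U1 := U :\ x; pose U2 := [set y in U1 | ~~ J x y].
have U1U : U1 \subset U by exact: subD1set.
have U2U1 : U2 \subset U1 by apply/fintype.subsetP=> y; rewrite inE => /andP[].
have card1 : (#|U| = #|U1|.+1)%N by rewrite (cardsD1 x) xU.
have U1m : (#|U1| < m)%N by rewrite -ltnS -card1.
have U2m : (#|U2| < m)%N by apply: leq_ltn_trans U1m; exact: subset_leq_card.
have [dec1 [light1 cov1]] :=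
  IHm U1 U1m (fun W h => hU W (fintype.subset_trans h U1U)).
have [dec2 [light2 cov2]] := IHm U2 U2m
  (fun W h => hU W (fintype.subset_trans h (fintype.subset_trans U2U1 U1U))).
have U2card : #|U2|%:R <= #|U|%:R * (1 - rho).
  have : (#|U2| + #|[set y in U | J x y]| <= #|U|)%N.
    rewrite -cardsUI (_ : U2 :&: _ = finset.set0) ?cards0 ?addn0; last first.
      by apply/finset.setP=> y; rewrite !inE; case: (J x y); rewrite ?andbF.
    apply/subset_leq_card/fintype.subsetP=> y.
    by rewrite !inE => /orP[/andP[/andP[_ ->]]|/andP[->]].
  by rewrite -(ler_nat R) natrD; move: deg; nra.
(* The decoder replays the run from the fingerprint alone: [x \in A] tells which branch was taken,
   and each recorded vertex is put back at a cost of at most [B]. *)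
exists (fun A : {set T} => if x \in A then x |: dec2 (A :\ x) else dec1 A); split.
  move=> A; case: ifP => // xA; rewrite (cardsD1 x A) xA add1n -natr1.
  have := light2 (A :\ x); have /andP[F0 FxB] := FB x.
  have : \sum_(y in x |: dec2 (A :\ x)) F y <= F x + \sum_(y in dec2 (A :\ x)) F y.
    have [xd|xd] := boolP (x \in dec2 (A :\ x)); last by rewrite big_setU1.
    have /finset.setUidPr -> : [set x] \subset dec2 (A :\ x) by rewrite finset.sub1set.
    by rewrite lerDr.
  by lra.
move=> I IU ind; have [xI|xI] := boolP (x \in I); last first.
  have IU1 : I \subset U1 by rewrite subsetD1 IU.
  have [A [AI IA Al]] := cov1 I IU1 ind.
  exists A; rewrite ifN; last by apply: contra xI; exact: (fintype.subsetP AI).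
  split=> // l hl; apply: Al; apply: le_lt_trans hl.
  by rewrite ler_wpM2r ?ler_nat ?subset_leq_card // exprn_ge0 // subr_ge0.
have IU2 : I :\ x \subset U2.
  apply/fintype.subsetP=> y; rewrite !inE => /andP[yx yI].
  by rewrite yx (fintype.subsetP IU) //= ind.
have ind2 : {in I :\ x &, forall y z, ~~ J y z}.
  by move=> y z /setD1P[_ yI] /setD1P[_ zI]; exact: ind.
have [A [AI IA Al]] := cov2 _ IU2 ind2.
have xA : x \notin A.
  by apply/negP=> /(fintype.subsetP AI); rewrite !inE eqxx.
exists (x |: A); rewrite setU11 finset.setU1K //; split.
- rewrite finset.subUset finset.sub1set xI (fintype.subset_trans AI) //; exact: subD1set.
- by rewrite -(finset.setD1K xI) finset.setUS.
(* [l = 0] is excluded: it would force [#|U| < 1], but [x] lies in [U]. *)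
case=> [|l].
  by rewrite expr0 mulr1 ltrn1 card1.
rewrite exprS mulrA => hl; rewrite cardsU1 xA add1n ltnS; apply: Al.
by apply: le_lt_trans hl; rewrite ler_wpM2r // exprn_ge0 // subr_ge0.
Qed.

(** * Random samples *)

(** The fibre of a uniform [h] over [ord0] is a random set of density [1 / k.+1]. The variables
    [x (h v)] are centred and independent with variance [k], so only diagonal terms survive in the
    square. *)
Lemma second_moment_ffun (R : numDomainType) (V : finType) (k : nat) (A : {set V}) :
  \sum_(h : {ffun V -> 'I_k.+1})
     (k.+1%:R * #|[set v in A | h v == ord0]|%:R - #|A|%:R : R) ^+ 2
  = k%:R * #|A|%:R * #|{ffun V -> 'I_k.+1}|%:R.
Proof.
pose x (j : 'I_k.+1) : R := k.+1%:R * (j == ord0)%:R - 1.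
have x0 : \sum_j x j = 0.
  rewrite sumrB sumr_const card_ord -mulr_sumr.
  have -> : \sum_(j < k.+1) (j == ord0)%:R = 1 :> R.
    rewrite (bigD1 (ord0 : 'I_k.+1)) //= big1 ?addr0 // => j.
    by move=> /negbTE ->.
  by rewrite mulr1 subrr.
have x2 : \sum_j x j ^+ 2 = k%:R * k.+1%:R.
  rewrite (bigD1 ord0) //= {1}/x eqxx mulr1 (eq_bigr (fun=> 1)); last first.
    by move=> j /negbTE j0; rewrite /x j0 mulr0 sub0r sqrrN expr1n.
  rewrite sumr_const (cardC1 (ord0 : 'I_k.+1)) card_ord /= -natr1; ring.
have xh (h : {ffun V -> 'I_k.+1}) :
    (k.+1%:R * #|[set v in A | h v == ord0]|%:R - #|A|%:R : R) ^+ 2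
    = \sum_(u in A) \sum_(v in A) x (h u) * x (h v).
  have -> : k.+1%:R * #|[set v in A | h v == ord0]|%:R - #|A|%:R =
      \sum_(u in A) x (h u).
    rewrite sumrB sumr_const -mulr_sumr -natr_sum.
    by rewrite -sum1dep_card big_mkcondr.
  by rewrite expr2 mulr_suml; apply: eq_bigr => u _; rewrite mulr_sumr.
under eq_bigr do rewrite xh.
rewrite exchange_big /=.
rewrite (eq_bigr (fun=> k%:R * #|{ffun V -> 'I_k.+1}|%:R)); last first.
  move=> u uA; rewrite exchange_big (bigD1 u) //= [X in _ + X]big1.
    rewrite addr0.
    have -> : \sum_(h : {ffun V -> 'I_k.+1}) x (h u) * x (h u) =
        \sum_(h : {ffun V -> 'I_k.+1}) \prod_v (if v == u then x (h v) ^+ 2 else 1).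
      apply: eq_bigr => h _; rewrite (bigD1 u) //= eqxx big1 ?mulr1 //.
      by move=> v /negbTE ->.
    rewrite -(bigA_distr_bigA (fun v j => if v == u then x j ^+ 2 else 1)).
    rewrite (bigD1 u) //= eqxx x2 (eq_bigr (fun=> k.+1%:R)); last first.
      by move=> v /negbTE ->; rewrite sumr_const card_ord.
    rewrite -mulrA; congr (_ * _).
    by rewrite card_ffun card_ord natrX prodr_const (cardC1 u) -exprS prednK //;
       apply/card_gt0P; exists u.
  (* For [w != u] the sum over [h] factors, and the factor at [u] is [\sum_j x j = 0]. *)
  move=> w /andP[_ wu].
  have -> : \sum_(h : {ffun V -> 'I_k.+1}) x (h u) * x (h w) =
      \sum_(h : {ffun V -> 'I_k.+1})
         \prod_v (if v == u then x (h v) else if v == w then x (h v) else 1).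
    apply: eq_bigr => h _; rewrite (bigD1 u) //= eqxx (bigD1 w) //=.
    rewrite (negbTE wu) eqxx big1 ?mulr1 //.
    by move=> v /andP[/negbTE -> /negbTE ->].
  rewrite -(bigA_distr_bigA (fun v j => if v == u then x j else if v == w then x j else 1)).
  by rewrite (bigD1 u) //= eqxx x0 mul0r.
by rewrite sumr_const -mulr_natl; ring.
Qed.

(* A random set containing each point with probability [1 / k] is a good sample
   on average, by pairwise independence. *)
Lemma exists_sample (R : realDomainType) (V I : finType) (k : nat) (A : I -> {set V}) :
  (0 < k)%N ->
  exists S : {set V},
    \sum_i (k%:R * #|A i :&: S|%:R - #|A i|%:R : R) ^+ 2 <= k%:R * \sum_i #|A i|%:R.
Proof.
(* Averaging: if every set failed, summing over all [h] would contradict the second moment. *)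
case: k => // k _; apply/not_existsP => hS.
pose S (h : {ffun V -> 'I_k.+1}) := [set v | h v == ord0].
have lt h : k.+1%:R * \sum_i #|A i|%:R <
    \sum_i (k.+1%:R * #|A i :&: S h|%:R - #|A i|%:R : R) ^+ 2.
  by rewrite ltNge; apply/negP; exact: hS.
have : \sum_(h : {ffun V -> 'I_k.+1}) k.+1%:R * \sum_i (#|A i|%:R : R) <
    \sum_(h : {ffun V -> 'I_k.+1})
      \sum_i (k.+1%:R * #|A i :&: S h|%:R - #|A i|%:R : R) ^+ 2.
  apply: ltr_sum => [|h _]; last exact: lt.
  by apply/hasP; exists [ffun=> ord0]; rewrite ?mem_index_enum.
apply/negP; rewrite -leNgt exchange_big /= sumr_const.
rewrite (eq_bigr (fun i => k%:R * #|A i|%:R * #|{ffun V -> 'I_k.+1}|%:R)); last first.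
  move=> i _; rewrite -second_moment_ffun; apply: eq_bigr => h _.
  congr ((_ * _%:R - _) ^+ 2); apply: eq_card => v.
  by rewrite !inE.
rewrite -mulr_suml -mulr_sumr -[leRHS]mulr_natr ler_wpM2r //.
by rewrite ler_wpM2r ?ler_nat ?sumr_ge0.
Qed.

(** * C4-free graphs *)

Definition nbhd (n : nat) (H : sgraph n) (v : 'I_n) : {set 'I_n} :=
  [set w | adj H v w].

(** Containers belong to single vertices, so their weights live on ordered pairs; this symmetrises
    them into edge weights for the Chernoff bound. *)
Definition pair_weight (R : nmodType) (n : nat) (phi : 'I_n -> 'I_n -> R)
    (e : {set 'I_n}) : R :=
  \sum_v \sum_(w | [set v; w] == e) phi v w.

Lemma set2_eq (T : finType) (a b v w : T) : a != b ->
  ([set v; w] == [set a; b]) = (v == a) && (w == b) || (v == b) && (w == a).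
Proof.
move=> ab; apply/eqP/orP => [E|[]/andP[/eqP-> /eqP->] //]; last exact: finset.setUC.
have va : v \in [set a; b] by rewrite -E !inE eqxx.
have wa : w \in [set a; b] by rewrite -E !inE eqxx orbT.
have av : a \in [set v; w] by rewrite E !inE eqxx.
have bv : b \in [set v; w] by rewrite E !inE eqxx orbT.
move: va wa av bv; rewrite !inE.
by move=> /pred2P[]-> /pred2P[]->;
   rewrite ?eqxx ?(eq_sym b) ?(negbTE ab) //=; auto.
Qed.

Lemma pair_weight_set2 (R : nmodType) (n : nat) (phi : 'I_n -> 'I_n -> R)
    (a b : 'I_n) : a != b -> pair_weight phi [set a; b] = phi a b + phi b a.
Proof.
move=> ab; rewrite /pair_weight (bigD1 a) // (bigD1 b) 1?eq_sym //=.
rewrite (big_pred1 b); last first.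
  by move=> w; rewrite set2_eq // eqxx (negbTE ab) /= orbF.
rewrite (big_pred1 a); last first.
  by move=> w; rewrite set2_eq // eqxx eq_sym (negbTE ab).
rewrite big1 ?addr0 // => v /andP[va vb]; rewrite big_pred0 // => w.
by rewrite set2_eq // (negbTE va) (negbTE vb).
Qed.

Lemma sum_pair_weight (R : nmodType) (n : nat) (phi : 'I_n -> 'I_n -> R)
    (E : {set {set 'I_n}}) :
  \sum_(e in E) pair_weight phi e = \sum_v \sum_(w | [set v; w] \in E) phi v w.
Proof.
rewrite exchange_big; apply: eq_bigr => v _ /=.
rewrite (exchange_big_dep predT) //= [RHS]big_mkcond.
apply: eq_bigr => w _; case: ifPn => vw.
  rewrite (big_pred1 [set v; w]) // => e /=; rewrite eq_sym.
  by case: eqP => [->|]; rewrite ?andbF ?vw.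
rewrite big_pred0 // => e; rewrite eq_sym.
by case: eqP => [->|]; rewrite ?andbF ?(negbTE vw).
Qed.

Lemma in_pairsP (n : nat) (e : {set 'I_n}) :
  reflect (exists a b, a != b /\ e = [set a; b]) (e \in pairs n).
Proof. by rewrite inE; exact: cards2P. Qed.

Section Neighbourhoods.
Variables (n : nat) (H : sgraph n).
Local Notation N := (nbhd H).

Lemma adj_sym (v w : 'I_n) : adj H v w = adj H w v.
Proof. by rewrite /adj finset.setUC. Qed.

Lemma adj_neq (v w : 'I_n) : adj H v w -> v != w.
Proof.
move=> /(fintype.subsetP (edges_pairs H)); rewrite inE cards2.
by case: (v != w).
Qed.

Lemma in_nbhdC (v w : 'I_n) : (w \in N v) = (v \in N w).
Proof. by rewrite !inE adj_sym. Qed.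

Lemma handshake : (\sum_v #|N v| = 2 * #|edges H|)%N.
Proof.
transitivity (\sum_v \sum_(w | [set v; w] \in edges H) 1)%N.
  by apply: eq_bigr => v _; rewrite sum1dep_card; apply: eq_card => w; rewrite !inE.
rewrite -(sum_pair_weight (fun _ _ => 1%N : nat)) mulnC -sum_nat_const.
apply: eq_bigr => e /(fintype.subsetP (edges_pairs H)) /in_pairsP[a [b [ab ->]]].
by rewrite pair_weight_set2.
Qed.

Hypothesis H_free : C4_free H.

(** Two common neighbours [u], [v] would close the cycle [x u y v]. *)
Lemma C4_free_codegree (x y : 'I_n) : x != y -> (#|N x :&: N y| <= 1)%N.
Proof.
move=> xy; rewrite leqNgt; apply/negP => /card_gt1P[u [v [uI vI uv]]].
move: uI vI; rewrite !inE => /andP[xu yu] /andP[xv yv].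
move/negP: H_free; apply; apply/existsP; exists [tuple x; u; y; v].
rewrite /ucycleb /= xu adj_sym yu yv adj_sym xv /= !inE !negb_or.
rewrite xy uv !(adj_neq xu, adj_neq xv) (adj_neq yv) /= andbT.
by rewrite eq_sym (adj_neq yu).
Qed.

(** The sum counts the triples [x, y, v] with [v] adjacent to both others. For each [x], the term
    [y = x] gives at most [n], and the other [y] at most 1 each. *)
Lemma C4_free_sum_sqr_deg : (\sum_v #|N v| ^ 2 <= 2 * n ^ 2)%N.
Proof.
have -> : (\sum_v #|N v| ^ 2 = \sum_x \sum_y #|N x :&: N y|)%N.
  transitivity (\sum_v \sum_x \sum_y ((x \in N v) && (y \in N v) : nat))%N.
    apply: eq_bigr => v _; rewrite expnS expn1 -sum1_card big_distrl big_mkcond /=.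
    apply: eq_bigr => x _; case: (x \in N v) => /=; last by rewrite big1.
    by rewrite mul1n big_mkcond; apply: eq_bigr => y _; case: ifP.
  rewrite exchange_big; apply: eq_bigr => x _ /=.
  rewrite exchange_big; apply: eq_bigr => y _ /=.
  rewrite -sum1_card [RHS]big_mkcond; apply: eq_bigr => v _ /=.
  by rewrite finset.in_setI (in_nbhdC v x) (in_nbhdC v y); case: ifP.
have -> : (2 * n ^ 2 = \sum_(x < n) (n + n))%N.
  by rewrite sum_nat_const card_ord addnn -muln2 mulnA mulnn mulnC.
apply: leq_sum => x _; rewrite (bigD1 x) //= finset.setIid leq_add //.
  by rewrite -[leqRHS](card_ord n) max_card.
apply: (@leq_trans (\sum_(y | y != x) 1)).
  by apply: leq_sum => y yx; rewrite C4_free_codegree // eq_sym.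
by rewrite sum1_card -[leqRHS](card_ord n) max_card.
Qed.

(* The graph joining [u] and [w] when they have a common neighbour in [S]; for
   distinct [u] and [w] that neighbour is unique. *)
Lemma C4_free_sum_common_nbr (S U : {set 'I_n}) :
  (\sum_(s in S) #|N s :&: U| ^ 2 <=
   \sum_(w in U) #|[set u in U | (w != u) && [exists s in S, (w \in N s) && (u \in N s)]]|
   + \sum_(w in U) #|N w :&: S|)%N.
Proof.
have -> : (\sum_(s in S) #|N s :&: U| ^ 2 =
    \sum_(w in U) \sum_(u in U) #|[set s in S | (w \in N s) && (u \in N s)]|)%N.
  transitivity (\sum_(s in S) \sum_(w in U) \sum_(u in U)
      ((w \in N s) && (u \in N s) : nat))%N.
    apply: eq_bigr => s _; rewrite expnS expn1 -sum1_card big_distrl /=.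
    rewrite [LHS]big_mkcond [RHS]big_mkcond /=.
    apply: eq_bigr => w _; rewrite inE andbC; case: (w \in U) => //=.
    case: (w \in N s) => /=; last by rewrite big1.
    rewrite mul1n [LHS]big_mkcond [RHS]big_mkcond /=.
    by apply: eq_bigr => u _; rewrite inE andbC; case: (u \in U) => //=; case: ifP.
  rewrite exchange_big; apply: eq_bigr => w _ /=.
  rewrite exchange_big; apply: eq_bigr => u _ /=.
  rewrite -sum1dep_card [RHS]big_mkcondr.
  by apply: eq_bigr => s _ /=; case: ifP.
rewrite -big_split; apply: leq_sum => w wU /=.
(* The diagonal term [u = w] is the sampled degree of [w]; off the diagonal the count is at most 1,
   hence bounded by the indicator of a common neighbour. *)
rewrite (bigD1 w) //= addnC leq_add //; last first.
  by apply/subset_leq_card/fintype.subsetP => s; rewrite !inE adj_sym andbb andbC.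
rewrite -sum1dep_card.
have -> : (\sum_(u | (u \in U) && ((w != u) && [exists s in S, (w \in N s) && (u \in N s)])) 1 =
    \sum_(u in U | u != w) [exists s in S, (w \in N s) && (u \in N s)])%N.
  rewrite [LHS]big_mkcond [RHS]big_mkcond; apply: eq_bigr => u _.
  by rewrite (eq_sym w); case: (u \in U) => //=; case: (u != w) => //=; case: ifP.
apply: leq_sum => u /andP[_ uw]; rewrite eq_sym in uw.
case: (boolP [exists s in S, _]) => [_|/existsPn none].
  apply: leq_trans (C4_free_codegree uw).
  apply/subset_leq_card/fintype.subsetP => s.
  by rewrite !inE [adj H s w]adj_sym [adj H s u]adj_sym => /andP[_ /andP[-> ->]].
rewrite leqn0 cards_eq0; apply/eqP/finset.setP => s; rewrite !inE.
by apply/negbTE; move: (none s); rewrite !inE.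
Qed.

End Neighbourhoods.

(** * A small family of edge weights *)

(** Padding with [None] encodes all sets of at most [l] elements by exactly [(#|T| + 1) ^ l]
    codes. *)
Definition set_of_tuple (T : finType) (l : nat) (t : l.-tuple (option T)) : {set T} :=
  [set x in pmap id t].

Lemma card_set_of_tuple (T : finType) (l : nat) (t : l.-tuple (option T)) :
  (#|set_of_tuple t| <= l)%N.
Proof.
rewrite cardsE (leq_trans (card_size _)) // size_pmap.
by rewrite (leq_trans (count_size _ _)) // size_tuple.
Qed.

Lemma set_of_tuple_onto (T : finType) (l : nat) (A : {set T}) : (#|A| <= l)%N ->
  exists t : l.-tuple (option T), set_of_tuple t = A.
Proof.
move=> Al; pose s := map Some (enum A) ++ nseq (l - #|A|) None.
have sz : size s == l by rewrite size_cat size_map size_nseq -cardE subnKC.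
exists (Tuple sz); apply/finset.setP => x; rewrite inE mem_pmap map_id mem_cat.
by rewrite mem_map ?mem_enum ?mem_nseq ?andbF ?orbF // => y z [].
Qed.

Definition capped (R : numDomainType) (n : nat) (B : R) (dg : 'I_n -> 'I_n.+1) (w : 'I_n) : R :=
  Num.min (dg w)%:R B.

(** [E] stands for the revealed edges, oriented away from the sample, so that the relation can be
    rebuilt without knowing the graph. *)
Definition common_nbr (n : nat) (E : {set 'I_n * 'I_n}) (w u : 'I_n) : bool :=
  (w != u) && [exists s, ((s, w) \in E) && ((s, u) \in E)].

(* [S] is the sample whose incident edges are revealed; [W] is the set of
   vertices whose degree is well represented in [S]. *)
Definition sampled (R : numDomainType) (n : nat) (H : sgraph n) (M : nat)
    (B theta rho t : R) (S W : {set 'I_n}) : Prop :=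
  [/\ (\sum_(s in S) #|nbhd H s| <= M)%N,
      forall w, w \in W -> (0 < #|nbhd H w|)%N,
      forall U : {set 'I_n}, U \subset W ->
        theta < \sum_(w in U) Num.min #|nbhd H w|%:R B ->
        exists2 w, w \in U & rho * #|U|%:R <=
          #|[set u in U | (w != u) &&
             [exists s in S, (w \in nbhd H s) && (u \in nbhd H s)]]|%:R
    & t <= \sum_(v | v \notin S) \sum_(w in nbhd H v :&: W)
             Num.min #|nbhd H w|%:R B].

Section WeightFamily.
Variables (R : realType) (n M l : nat) (B theta rho t : R).
Hypotheses (B0 : 0 <= B) (theta0 : 0 <= theta) (rho1 : rho <= 1).
Hypothesis (l_large : n%:R * (1 - rho) ^+ l < 1).

(** Most codes [E], [dg] come from no graph, yet the weight bound must hold for all of them. Where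
    the degree condition fails, the empty container serves as a default. *)
Lemma decoder (E : {set 'I_n * 'I_n}) (dg : {ffun 'I_n -> 'I_n.+1}) :
  let U := [set w | 0 < dg w]%N in
  exists dec : {set 'I_n} -> {set 'I_n},
    (forall A, \sum_(x in dec A) capped B dg x <= theta + B * #|A|%:R) /\
    ((forall U' : {set 'I_n}, U' \subset U -> theta < \sum_(w in U') capped B dg w ->
        exists2 w, w \in U' & rho * #|U'|%:R <= #|[set u in U' | common_nbr E w u]|%:R) ->
     forall I : {set 'I_n}, I \subset U -> {in I &, forall x y, ~~ common_nbr E x y} ->
       exists A : {set 'I_n}, I \subset dec A /\ (#|A| <= l)%N).
Proof.
move=> U.
have capB x : 0 <= capped B dg x <= B.
  by rewrite /capped le_min ler0n B0 ge_min lexx orbT.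
have [hrich|nrich] := pselect (forall U' : {set 'I_n},
    U' \subset U -> theta < \sum_(w in U') capped B dg w ->
    exists2 w, w \in U' & rho * #|U'|%:R <= #|[set u in U' | common_nbr E w u]|%:R).
  have [dec [light cov]] := light_containers capB B0 theta0 rho1 hrich.
  exists dec; split=> // _ I IU ind.
  have [A [_ IA Al]] := cov I IU ind; exists A; split=> //; apply: Al.
  apply: le_lt_trans l_large; rewrite ler_wpM2r ?exprn_ge0 ?subr_ge0 //.
  by rewrite ler_nat -[leqRHS](card_ord n) max_card.
exists (fun=> finset.set0); split=> [A|//].
by rewrite big_set0 addr_ge0 // mulr_ge0.
Qed.

(** An index lists the edges at the sample, a degree sequence and one fingerprint per vertex; the
    three factors of the count are these. The weights depend on the index only, so a union bound
    over [I] handles all [H] at once. *)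
Lemma weight_family :
  exists (I : finType) (omega : I -> {set 'I_n} -> R),
    [/\ (#|I| = (n ^ 2).+1 ^ M * n.+1 ^ n * (n.+1 ^ l) ^ n)%N,
        forall i e, e \in pairs n -> 0 <= omega i e <= 2 * B,
        forall i, \sum_(e in pairs n) omega i e <= n%:R * (theta + B * l%:R)
      & forall (H : sgraph n) (S W : {set 'I_n}), C4_free H ->
          sampled H M B theta rho t S W ->
          exists i, t <= \sum_(e in edges H) omega i e].
Proof.
have [dec decP] := choice (fun x : {set 'I_n * 'I_n} * {ffun 'I_n -> 'I_n.+1} =>
  decoder x.1 x.2).
pose I : finType := (M.-tuple (option ('I_n * 'I_n)) * {ffun 'I_n -> 'I_n.+1} *
  {ffun 'I_n -> l.-tuple (option 'I_n)})%type.
pose cont (i : I) v := dec (set_of_tuple i.1.1, i.1.2) (set_of_tuple (i.2 v)).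
pose phi (i : I) v w : R := if w \in cont i v then capped B i.1.2 w else 0.
have capB (i : I) x : 0 <= capped B i.1.2 x <= B.
  by rewrite /capped le_min ler0n B0 ge_min lexx orbT.
have phiB (i : I) v w : 0 <= phi i v w <= B.
  by rewrite /phi; case: ifP => // _; rewrite lexx.
exists I, (fun i => pair_weight (phi i)); split.
- rewrite !card_prod !card_ffun !card_tuple !card_option card_prod !card_ord.
  by rewrite mulnn.
- move=> i e /in_pairsP[a [b [ab ->]]]; rewrite pair_weight_set2 //.
  by have /andP[? ?] := phiB i a b; have /andP[? ?] := phiB i b a; apply/andP; split; lra.
- move=> i; rewrite sum_pair_weight mulr_natl -[in leRHS](card_ord n) -sumr_const.
  apply: ler_sum => v _.
  apply: (@le_trans _ _ (\sum_(w in cont i v) capped B i.1.2 w)).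
    rewrite [leRHS]big_mkcond [leLHS]big_mkcond; apply: ler_sum => w _ /=.
    by case: ifP => // _; have /andP[] := phiB i v w.
  have [light _] := decP (set_of_tuple i.1.1, i.1.2).
  apply: (le_trans (light _)); rewrite lerD2l ler_wpM2l // ler_nat.
  exact: card_set_of_tuple.
move=> H S W H_free [SM W0 rich tsum].
pose E := [set x : 'I_n * 'I_n | (x.1 \in S) && (x.2 \in nbhd H x.1)].
have EM : (#|E| <= M)%N.
  apply: leq_trans SM; rewrite -sum1_card.
  have -> : (\sum_(s in S) #|nbhd H s| = \sum_(s in S) \sum_(w in nbhd H s) 1)%N.
    by apply: eq_bigr => s _; rewrite sum1_card.
  by rewrite pair_big_dep; apply: eq_leq; apply: eq_bigl => x; rewrite inE.
have [tE tEP] := set_of_tuple_onto EM.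
have deg_lt w : (#|nbhd H w| < n.+1)%N.
  by rewrite ltnS -[leqRHS](card_ord n) max_card.
(* Degrees outside [W] are recorded as 0, so that [W] itself is read off as the support of [dg]. *)
pose dg : {ffun 'I_n -> 'I_n.+1} :=
  [ffun w => if w \in W then Ordinal (deg_lt w) else ord0].
have dgW w : w \in W -> capped B dg w = Num.min #|nbhd H w|%:R B.
  by move=> wW; rewrite /capped /dg ffunE wW.
have UW : [set w | 0 < dg w]%N = W.
  apply/finset.setP => w; rewrite inE /dg ffunE; case: ifPn => // wW.
  by rewrite /= W0.
have JE w u : common_nbr E w u = (w != u) &&
    [exists s in S, (w \in nbhd H s) && (u \in nbhd H s)].
  congr (_ && _); apply: eq_existsb => s; rewrite !inE /=.
  by case: (s \in S).
have [light cov] := decP (E, dg).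
have {cov} cov v : exists A : {set 'I_n}, (#|A| <= l)%N /\
    (v \notin S -> nbhd H v :&: W \subset dec (E, dg) A).
  have [vS|vS] := boolP (v \in S); first by exists finset.set0; rewrite cards0.
  have [|||A [IA Al]] := cov _ (nbhd H v :&: W); last by exists A.
  - move=> U UsubW heavy; have [||w wU wdeg] := rich U.
    + by rewrite -UW.
    + move: heavy; rewrite (eq_bigr (fun w => Num.min #|nbhd H w|%:R B)) // => w wU.
      by rewrite dgW // -UW (fintype.subsetP UsubW).
    exists w => //; apply: le_trans wdeg _; rewrite ler_nat subset_leq_card //.
    by apply/fintype.subsetP => u; rewrite !inE JE.
  - by rewrite /= UW finset.subsetIr.
  (* Two neighbours of [v] joined through some [s] in [S] would be two common neighbours of [v] and
     [s], which are distinct as [v] is outside [S]. *)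
  - move=> w u; rewrite !finset.in_setI => /andP[wv _] /andP[uv _].
    rewrite JE negb_and -implybE; apply/implyP => wu.
    apply/existsPn => s; rewrite negb_and -implybE; apply/implyP => sS.
    apply/negP => /andP[ws us].
    have vs : v != s by apply: contraNneq vS => ->.
    have := C4_free_codegree H_free vs; rewrite leqNgt => /negP; apply.
    by apply/card_gt1P; exists w, u; rewrite !finset.in_setI wv ws uv us.
have [A AP] := choice cov.
have tA v : exists tv : l.-tuple (option 'I_n), set_of_tuple tv = A v.
  by apply: set_of_tuple_onto; case: (AP v).
have [f fP] := choice tA.
exists (tE, dg, [ffun v => f v]).
apply: (le_trans tsum); rewrite sum_pair_weight [leLHS]big_mkcond; apply: ler_sum => v _ /=.
have sum0 : 0 <= \sum_(w | [set v; w] \in edges H) phi (tE, dg, [ffun v => f v]) v w.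
  by apply: sumr_ge0 => w _; have /andP[] := phiB (tE, dg, [ffun v => f v]) v w.
case: ifPn => // vS; rewrite [leRHS]big_mkcond [leLHS]big_mkcond; apply: ler_sum => w _ /=.
have /andP[phi0 _] := phiB (tE, dg, [ffun v => f v]) v w.
case: ifPn => [wvW|_]; last by case: ifP.
have [_ /(_ vS) /fintype.subsetP /(_ w wvW) wdec] := AP v.
have /setIP[wv wW] := wvW; move: wv; rewrite inE /adj => ->.
by rewrite /phi /cont /= ffunE fP tEP wdec dgW.
Qed.

End WeightFamily.

(** * Dense C4-free graphs are well sampled *)

(* Cauchy-Schwarz over the sample gives [aX <= Q] with [a = k X / ((1 + delta) n)],
   and [a > 1 + delta] by the lower bound on [Y]. *)
Lemma rich_arith (R : realFieldType) (X Y Q s k r delta eta u : R) :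
  0 < delta -> 5 * delta <= 1 -> 0 < k -> 0 < r -> 0 < eta -> 0 <= u ->
  (1 - delta) * Y <= k * X -> (1 + 4 * delta) * r ^+ 2 < Y -> eta * r * u <= Y ->
  k * s <= (1 + delta) * r ^+ 2 ->
  (forall a, 2 * a * X - a ^+ 2 * s <= Q) ->
  Q <= eta ^+ 2 * delta / (4 * k) * u ^+ 2 + X -> False.
Proof.
move=> d0 d5 k0 r0 eta0 u0 hX hY hu hs hQ1 hQ2.
have n0 : 0 < r ^+ 2 by rewrite exprn_gt0.
move nE : (r ^+ 2) n0 hY hs => n n0 hY hs.
have d1 : 0 < 1 + delta by lra.
have dn : 0 < (1 + delta) * n by rewrite mulr_gt0.
have [a kX] : exists a, k * X = a * ((1 + delta) * n).
  by exists (k * X / ((1 + delta) * n)); rewrite divfK // gt_eqF.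
have a1 : 1 + delta < a.
  rewrite -(ltr_pM2r dn) -kX; apply: lt_le_trans hX.
  have : (1 - delta) * ((1 + 4 * delta) * n) < (1 - delta) * Y.
    by rewrite ltr_pM2l //; lra.
  apply: le_lt_trans; rewrite mulrA [leRHS]mulrA ler_pM2r //.
  (* This is [(1 + delta) ^+ 2 <= (1 - delta) * (1 + 4 * delta)]. *)
  have : 0 <= delta * (1 - 5 * delta) by rewrite mulr_ge0 //; lra.
  nra.
have a0 : 0 < a by lra.
have asX : a * s <= X.
  rewrite -(ler_pM2l k0) kX mulrCA ler_pM2l //.
have aXQ : a * X <= Q.
  apply: le_trans (hQ1 a).
  have : a * (a * s) <= a * X by rewrite ler_pM2l.
  by rewrite expr2; lra.
have h4 : (a - 1) * (a * ((1 + delta) * n)) <= eta ^+ 2 * delta * u ^+ 2 / 4.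
  have : (a - 1) * X <= eta ^+ 2 * delta / (4 * k) * u ^+ 2 by lra.
  rewrite -(ler_pM2l k0) mulrCA kX => /le_trans; apply.
  rewrite le_eqVlt; apply/orP; left; apply/eqP; field; exact: lt0r_neq0.
have h5 : eta ^+ 2 * u ^+ 2 * (1 - delta) ^+ 2 <= a ^+ 2 * (1 + delta) ^+ 2 * n.
  have lhs0 : 0 <= (1 - delta) * (eta * r * u).
    by rewrite !mulr_ge0 // ?ltW //; lra.
  have : (1 - delta) * (eta * r * u) <= a * ((1 + delta) * n).
    by rewrite -kX (le_trans _ hX) // ler_wpM2l //; lra.
  move=> le1; have : ((1 - delta) * (eta * r * u)) ^+ 2 <= (a * ((1 + delta) * n)) ^+ 2.
    by rewrite ler_sqr // nnegrE // (le_trans lhs0).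
  move=> le2; rewrite -(ler_pM2r n0).
  have -> : eta ^+ 2 * u ^+ 2 * (1 - delta) ^+ 2 * n = ((1 - delta) * (eta * r * u)) ^+ 2.
    by rewrite -nE; ring.
  have -> // : a ^+ 2 * (1 + delta) ^+ 2 * n * n = (a * ((1 + delta) * n)) ^+ 2 by ring.
have h6 : a * delta * (a * n) < (a - 1) * (a * ((1 + delta) * n)).
  have -> : (a - 1) * (a * ((1 + delta) * n)) = (a - 1) * (1 + delta) * (a * n) by ring.
  by rewrite ltr_pM2r ?mulr_gt0 //; lra.
have h7 : 4 * (a ^+ 2 * n) < eta ^+ 2 * u ^+ 2.
  have := lt_le_trans h6 h4.
  have -> : a * delta * (a * n) = delta * (a ^+ 2 * n) by ring.
  have -> : eta ^+ 2 * delta * u ^+ 2 / 4 = delta * (eta ^+ 2 * u ^+ 2 / 4) by ring.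
  by rewrite ltr_pM2l //; lra.
have an0 : 0 < a ^+ 2 * n by rewrite mulr_gt0 // exprn_gt0.
move: h5 h7; have -> : a ^+ 2 * (1 + delta) ^+ 2 * n = (1 + delta) ^+ 2 * (a ^+ 2 * n) by ring.
set P := a ^+ 2 * n in an0 *; set E := eta ^+ 2 * u ^+ 2 => h5 h7.
(* With [delta <= 1 / 5], [h5] gives [E <= 9 / 4 * P], against [4 * P < E]. *)
have : (1 + delta) ^+ 2 * P <= 36 / 25 * P by rewrite ler_pM2r //; nra.
have : 16 / 25 * E <= E * (1 - delta) ^+ 2.
  by rewrite mulrC ler_wpM2l //; [lra|nra].
lra.
Qed.

Lemma sum_nbhdI (n : nat) (H : sgraph n) (S U : {set 'I_n}) :
  (\sum_(s in S) #|nbhd H s :&: U| = \sum_(w in U) #|nbhd H w :&: S|)%N.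
Proof.
transitivity (\sum_(s in S) \sum_(w in U) (w \in nbhd H s : nat))%N.
  apply: eq_bigr => s _; rewrite -sum1_card big_mkcond [RHS]big_mkcond.
  by apply: eq_bigr => w _; rewrite finset.in_setI andbC; case: (w \in U) => //=; case: ifP.
rewrite exchange_big; apply: eq_bigr => w _ /=.
rewrite -sum1_card big_mkcond [RHS]big_mkcond.
apply: eq_bigr => s _; rewrite finset.in_setI andbC (in_nbhdC H w).
by case: (s \in S) => //=; case: ifP.
Qed.

Section DenseIsSampled.
Variables (R : realType) (n k M : nat) (H : sgraph n) (y beta L eta delta : R).
Hypotheses (y1 : 1 <= y) (yn : y ^+ 8 = n%:R).
Hypotheses (ky : y ^+ 2 <= k%:R) (ky2 : k%:R <= 2 * y ^+ 2).
Hypotheses (delta0 : 0 < delta) (delta5 : 5 * delta <= 1).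
Hypotheses (eta0 : 0 < eta) (L0 : 0 < L) (b0 : 0 <= beta - 2 / L).
Hypotheses (ylarge : 6 <= delta ^+ 2 * y ^+ 2) (My : 2 * y ^+ 11 <= M%:R).
Hypotheses (H_free : C4_free H).

Local Notation N := (nbhd H).
Local Notation d v := (#|N v|%:R : R).
Local Notation m v := (Num.min (d v) (L * y ^+ 4)).

Let y0 : 0 < y. Proof. exact: lt_le_trans y1. Qed.
Let yX j : 0 < y ^+ j. Proof. exact: exprn_gt0. Qed.
Let k0 : 0 < (k%:R : R). Proof. exact: lt_le_trans ky. Qed.

Let sum_cst (P : {set 'I_n}) (c : R) : \sum_(v in P) c = #|P|%:R * c.
Proof. by rewrite sumr_const mulr_natl. Qed.

Let sum_cstT (c : R) : \sum_(v < n) c = y ^+ 8 * c.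
Proof. by rewrite sumr_const card_ord yn mulr_natl. Qed.

(** With [y = n^(1/8)], the typical degree [sqrt n] is [y ^+ 4], the scale of the edge count is
    [y ^+ 12], and [n^2] is [y ^+ 16]. *)
Lemma sum_sqr_deg_le : \sum_(v < n) d v ^+ 2 <= 2 * y ^+ 16.
Proof.
have := C4_free_sum_sqr_deg H_free; rewrite -(ler_nat R) natr_sum natrM natrX.
rewrite -yn -exprM => h; apply: le_trans h.
by apply: ler_sum => v _; rewrite natrX.
Qed.

Lemma sum_deg_le : 2 * \sum_(v < n) d v <= 3 * y ^+ 12.
Proof.
rewrite -(ler_pM2l (yX 4)).
have : \sum_(v < n) (2 * y ^+ 4 * d v) <= \sum_(v < n) (y ^+ 8 + d v ^+ 2).
  apply: ler_sum => v _; have := sqr_ge0 (y ^+ 4 - d v).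
  have -> : (y ^+ 4 - d v) ^+ 2 = y ^+ 8 + d v ^+ 2 - 2 * y ^+ 4 * d v by ring.
  by lra.
rewrite -mulr_sumr big_split /= sum_cstT.
have := sum_sqr_deg_le.
have -> : y ^+ 8 * y ^+ 8 = y ^+ 16 by ring.
have -> : y ^+ 4 * (3 * y ^+ 12) = 3 * y ^+ 16 by ring.
by lra.
Qed.

Lemma good_sample : exists S : {set 'I_n},
  k%:R * #|S|%:R <= (1 + delta) * y ^+ 8 /\
  \sum_(v < n) (k%:R * #|N v :&: S|%:R - d v) ^+ 2 <= 6 * y ^+ 14.
Proof.
(* The extra index [ord0] carries the whole vertex set, so one sample controls its own size together
   with all neighbourhoods. *)
pose A (i : 'I_n.+1) : {set 'I_n} := if unlift ord0 i is Some v then N v else [set: 'I_n].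
have kpos : (0 < k)%N by rewrite -(ltr_nat R).
have [S] := exists_sample R A kpos.
have A0 : A ord0 = [set: 'I_n] by rewrite /A unlift_none.
rewrite !big_ord_recl A0 finset.setTI cardsT card_ord.
under eq_bigr => v _ do rewrite /A liftK.
under [X in _ <= _ * (_ + X)]eq_bigr => v _ do rewrite /A liftK.
rewrite -yn => Sle.
have Sle6 : (k%:R * #|S|%:R - y ^+ 8) ^+ 2 +
    \sum_(v < n) (k%:R * #|N v :&: S|%:R - d v) ^+ 2 <= 6 * y ^+ 14.
  apply: (le_trans Sle).
  have y812 : y ^+ 8 <= y ^+ 12 by rewrite ler_weXn2l.
  have h : y ^+ 8 + \sum_(v < n) d v <= 3 * y ^+ 12 by have := sum_deg_le; have := yX 12; lra.
  have h0 : 0 <= y ^+ 8 + \sum_(v < n) d v by rewrite addr_ge0 ?sumr_ge0 // ltW.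
  have -> : 6 * y ^+ 14 = (2 * y ^+ 2) * (3 * y ^+ 12) by ring.
  exact: ler_pM.
have sq0 := sqr_ge0 (k%:R * #|S|%:R - y ^+ 8).
have sum0 : 0 <= \sum_(v < n) (k%:R * #|N v :&: S|%:R - d v) ^+ 2.
  by apply: sumr_ge0 => v _; exact: sqr_ge0.
exists S; split; last by lra.
rewrite leNgt; apply/negP => big.
(* A sample this large would alone contribute more than [delta ^+ 2 * y ^+ 16 >= 6 * y ^+ 14]. *)
have h1 : delta * y ^+ 8 < k%:R * #|S|%:R - y ^+ 8 by lra.
have : (delta * y ^+ 8) ^+ 2 < (k%:R * #|S|%:R - y ^+ 8) ^+ 2.
  rewrite ltr_sqr // nnegrE ?(ltW (mulr_gt0 _ _)) // ltW //.
  by apply: lt_trans h1; rewrite mulr_gt0.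
have -> : (delta * y ^+ 8) ^+ 2 = delta ^+ 2 * y ^+ 2 * y ^+ 14 by ring.
have : 6 * y ^+ 14 <= delta ^+ 2 * y ^+ 2 * y ^+ 14 by rewrite ler_pM2r.
lra.
Qed.

(** [W] keeps the vertices of degree at least [eta * sqrt n] that are not undersampled. The three
    losses, each times the cap, come from low degrees, from undersampled vertices (Chebyshev) and
    from edges into [S]; [2 / L] is the loss from capping. *)
Lemma dense_sampled : beta * y ^+ 12 <= \sum_(v < n) d v ->
  exists S W, sampled H M (L * y ^+ 4) ((1 + 4 * delta) * y ^+ 8)
    (eta ^+ 2 * delta / (4 * k%:R))
    ((beta - 2 / L) ^+ 2 * y ^+ 16 -
       L * y ^+ 4 * (eta * y ^+ 12 + 6 * y ^+ 10 / (delta ^+ 2 * eta) + 2 * y ^+ 11))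
    S W.
Proof.
move=> dense; have [S [Scard Sdev]] := good_sample.
have [d0 d5] := (delta0, delta5).
pose ds v : R := #|N v :&: S|%:R.
pose W := [set w | (eta * y ^+ 4 <= d w) && ((1 - delta) * d w <= k%:R * ds w)].
have m0 v : 0 <= m v by rewrite le_min ler0n mulr_ge0 // ltW.
have md v : m v <= d v by rewrite ge_min lexx.
have mB v : m v <= L * y ^+ 4 by rewrite ge_min lexx orbT.
(* The level [y ^+ 5] balances [#|S| <= 2 * y ^+ 6] against the sum of squares [2 * y ^+ 16]. *)
have degS : \sum_(s in S) d s <= 2 * y ^+ 11.
  rewrite -(ler_pM2l (yX 5)).
  have : \sum_(s in S) (2 * (y ^+ 5 * d s)) <= \sum_(s in S) (y ^+ 10 + d s ^+ 2).
    apply: ler_sum => v _; have := sqr_ge0 (y ^+ 5 - d v).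
    have -> : (y ^+ 5 - d v) ^+ 2 = y ^+ 10 + d v ^+ 2 - 2 * (y ^+ 5 * d v) by ring.
    by lra.
  rewrite -!mulr_sumr big_split /= sum_cst.
  have : \sum_(s in S) d s ^+ 2 <= 2 * y ^+ 16.
    apply: le_trans sum_sqr_deg_le; rewrite [leLHS]big_mkcond; apply: ler_sum => v _.
    by case: ifP => // _; exact: sqr_ge0.
  have : #|S|%:R * y ^+ 10 <= 2 * y ^+ 16.
    have -> : #|S|%:R * y ^+ 10 = y ^+ 2 * #|S|%:R * y ^+ 8 by ring.
    have -> : 2 * y ^+ 16 = 2 * y ^+ 8 * y ^+ 8 by ring.
    rewrite ler_pM2r //.
    have : y ^+ 2 * #|S|%:R <= k%:R * #|S|%:R by rewrite ler_wpM2r.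
    have : (1 + delta) * y ^+ 8 <= 2 * y ^+ 8 by rewrite ler_pM2r ?yX //; lra.
    lra.
  have -> : y ^+ 5 * (2 * y ^+ 11) = 2 * y ^+ 16 by ring.
  lra.
exists S, W; split.
- by rewrite -(ler_nat R) natr_sum (le_trans degS).
- move=> w; rewrite inE => /andP[h _]; rewrite -(ltr_nat R).
  by apply: lt_le_trans h; rewrite mulr_gt0.
- move=> U UW heavy.
  pose deg w := #|[set u in U | (w != u) &&
             [exists s in S, (w \in nbhd H s) && (u \in nbhd H s)]]|.
  have [[w wU hw]|none] := pselect (exists2 w, w \in U &
      eta ^+ 2 * delta / (4 * k%:R) * #|U|%:R <= (deg w)%:R).
    by exists w.
  exfalso.
  pose Q : R := \sum_(s in S) #|N s :&: U|%:R ^+ 2.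
  pose X : R := \sum_(w in U) ds w.
  have XE : X = \sum_(s in S) #|N s :&: U|%:R by rewrite /X /ds -!natr_sum sum_nbhdI.
  apply: (@rich_arith R X (\sum_(w in U) d w) Q #|S|%:R k%:R (y ^+ 4) delta eta #|U|%:R) => //.
  + rewrite /X !mulr_sumr; apply: ler_sum => w /(fintype.subsetP UW).
    by rewrite inE => /andP[].
  + rewrite -exprM; apply: (lt_le_trans heavy); apply: ler_sum => w _; exact: md.
  + rewrite mulrC -sum_cst; apply: ler_sum => w /(fintype.subsetP UW).
    by rewrite inE => /andP[].
  + by rewrite -exprM.
  (* Cauchy-Schwarz in tangent form: a square minus its tangent at [a] is nonnegative. *)
  + move=> a; rewrite XE mulr_sumr [a ^+ 2 * _]mulrC -sum_cst -sumrB; apply: ler_sum => s _.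
    have := sqr_ge0 (#|N s :&: U|%:R - a : R).
    set x := #|N s :&: U|%:R; have -> : (x - a) ^+ 2 = x ^+ 2 + a ^+ 2 - 2 * a * x by ring.
    lra.
  (* By [none], every degree inside [U] is below [rho * #|U|]. *)
  + have := C4_free_sum_common_nbr H_free S U.
    rewrite -(ler_nat R) natrD !natr_sum => h.
    have -> : Q = \sum_(s in S) (#|N s :&: U| ^ 2)%:R.
      by apply: eq_bigr => s _; rewrite natrX.
    apply: (le_trans h); rewrite lerD2r.
    rewrite [X in _ <= _ * X]expr2 mulrCA -sum_cst; apply: ler_sum => w wU.
    by apply: ltW; rewrite ltNge; apply/negP => hw; apply: none; exists w.
have tE : \sum_(v | v \notin S) \sum_(w in nbhd H v :&: W) m w =
    \sum_(w in W) m w * (d w - ds w).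
  transitivity (\sum_(v | v \notin S) \sum_(w in W) (m w * (w \in N v)%:R)).
    apply: eq_bigr => v _; rewrite [LHS]big_mkcond [RHS]big_mkcond.
    apply: eq_bigr => w _; rewrite finset.in_setI andbC; case: (w \in W) => //=.
    by case: (w \in N v); rewrite ?mulr1 ?mulr0.
  rewrite exchange_big; apply: eq_bigr => w _ /=; rewrite -mulr_sumr; congr (_ * _).
  rewrite -(cardsID S (N w)) natrD addrAC subrr add0r -sum1_card natr_sum.
  rewrite [LHS]big_mkcond [RHS]big_mkcond; apply: eq_bigr => v _.
  by rewrite finset.in_setD (in_nbhdC H w); case: (v \notin S) => //=; case: ifP.
rewrite tE.
(* A vertex outside [W] has degree at most [eta * y ^+ 4], or its deviation exceeds [delta * d w]
   with [d w > eta * y ^+ 4], so that [delta ^+ 2 * eta * y ^+ 4 * d w] is at most the squared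
   deviation. *)
have offW : \sum_(w | w \notin W) d w <= eta * y ^+ 12 + 6 * y ^+ 10 / (delta ^+ 2 * eta).
  have de0 : 0 < delta ^+ 2 * eta by rewrite mulr_gt0 // exprn_gt0.
  rewrite -(ler_pM2l (mulr_gt0 de0 (yX 4))).
  have -> : delta ^+ 2 * eta * y ^+ 4 * (eta * y ^+ 12 + 6 * y ^+ 10 / (delta ^+ 2 * eta)) =
      y ^+ 8 * (delta ^+ 2 * eta ^+ 2 * y ^+ 8) + 6 * y ^+ 14.
    by field; rewrite !lt0r_neq0.
  apply: (@le_trans _ _ (\sum_(v < n) (delta ^+ 2 * eta ^+ 2 * y ^+ 8 + (k%:R * ds v - d v) ^+ 2))).
    rewrite mulr_sumr [leLHS]big_mkcond; apply: ler_sum => w _ /=.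
    have t1 : 0 <= delta ^+ 2 * eta ^+ 2 * y ^+ 8 by rewrite !mulr_ge0 // ?exprn_ge0 // ltW.
    have t2 := sqr_ge0 (k%:R * ds w - d w).
    have dw0 : 0 <= d w by [].
    case: ifPn; last by rewrite addr_ge0.
    rewrite inE negb_and -!ltNge => /orP[low|under].
      have : delta ^+ 2 * eta * y ^+ 4 * d w <= delta ^+ 2 * eta * y ^+ 4 * (eta * y ^+ 4).
        by rewrite ler_pM2l ?mulr_gt0 // ltW.
      have -> : delta ^+ 2 * eta * y ^+ 4 * (eta * y ^+ 4) = delta ^+ 2 * eta ^+ 2 * y ^+ 8 by ring.
      lra.
    have [low|high] := lerP (d w) (eta * y ^+ 4).
      have : delta ^+ 2 * eta * y ^+ 4 * d w <= delta ^+ 2 * eta * y ^+ 4 * (eta * y ^+ 4).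
        by rewrite ler_pM2l ?mulr_gt0.
      have -> : delta ^+ 2 * eta * y ^+ 4 * (eta * y ^+ 4) = delta ^+ 2 * eta ^+ 2 * y ^+ 8 by ring.
      lra.
    have : (delta * d w) ^+ 2 <= (d w - k%:R * ds w) ^+ 2.
      have h1 : 0 <= delta * d w by rewrite mulr_ge0 // ltW.
      have h2 : delta * d w <= d w - k%:R * ds w by lra.
      by rewrite ler_sqr // nnegrE // (le_trans h1).
    have : delta ^+ 2 * (eta * y ^+ 4 * d w) <= (delta * d w) ^+ 2.
      by rewrite exprMn ler_pM2l ?exprn_gt0 // expr2 ler_wpM2r // ltW.
    rewrite -(sqrrN (d w - _)) opprB; lra.
  by rewrite big_split /= sum_cstT lerD2l.
have dsS : \sum_(v < n) ds v <= 2 * y ^+ 11.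
  apply: le_trans degS; rewrite /ds -!natr_sum ler_nat.
  have := sum_nbhdI H S [set: 'I_n].
  rewrite (eq_bigr (fun s => #|N s|)) => [->|s _]; last by rewrite finset.setIT.
  by rewrite big_mkcond /= [leqRHS]big_mkcond leq_sum // => v _; rewrite inE.
(* Capping loses at most [d v ^+ 2 / (L * y ^+ 4)] at [v]. *)
have summ : (beta - 2 / L) * y ^+ 12 <= \sum_(v < n) m v.
  have Ly : 0 < L * y ^+ 4 by rewrite mulr_gt0.
  rewrite -(ler_pM2l Ly) mulr_sumr.
  apply: (@le_trans _ _ (\sum_(v < n) (L * y ^+ 4 * d v - d v ^+ 2))).
    rewrite sumrB -mulr_sumr.
    have -> : L * y ^+ 4 * ((beta - 2 / L) * y ^+ 12) =
      L * y ^+ 4 * (beta * y ^+ 12) - 2 * y ^+ 16 by field; exact: lt0r_neq0.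
    by rewrite lerB ?sum_sqr_deg_le // ler_pM2l.
  apply: ler_sum => v _; have dv0 : 0 <= d v by [].
  rewrite /Num.min; case: ifP => [_|/negbT]; first by rewrite gerBl sqr_ge0.
  by rewrite -leNgt; nra.
(* Here [m v * d v >= m v ^+ 2], and the square is bounded below by its tangent at the mean level
   [b * y ^+ 4]. *)
have summd : (beta - 2 / L) ^+ 2 * y ^+ 16 <= \sum_(v < n) m v * d v.
  have := b0; move: summ; set b := beta - 2 / L => summ bpos.
  apply: (@le_trans _ _ (\sum_(v < n) (2 * (b * y ^+ 4) * m v - (b * y ^+ 4) ^+ 2))).
    rewrite sumrB sum_cstT -mulr_sumr.
    have : b * y ^+ 4 * (b * y ^+ 12) <= b * y ^+ 4 * \sum_(v < n) m v.
      by rewrite ler_wpM2l // mulr_ge0 // ltW.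
    have -> : b * y ^+ 4 * (b * y ^+ 12) = b ^+ 2 * y ^+ 16 by ring.
    have -> : y ^+ 8 * (b * y ^+ 4) ^+ 2 = b ^+ 2 * y ^+ 16 by ring.
    lra.
  apply: ler_sum => v _; have := sqr_ge0 (m v - b * y ^+ 4).
  have : m v * m v <= m v * d v by rewrite ler_wpM2l.
  move: (m v) => x; rewrite sqrrB -expr2; lra.
apply: (@le_trans _ _ (\sum_(v < n) m v * d v - L * y ^+ 4 * \sum_(w | w \notin W) d w
   - L * y ^+ 4 * \sum_(v < n) ds v)).
  have Ly : 0 <= L * y ^+ 4 by rewrite mulr_ge0 // ltW.
  have := ler_wpM2l Ly offW; have := ler_wpM2l Ly dsS; lra.
rewrite !mulr_sumr [X in _ - X - _]big_mkcond -!sumrB [leRHS]big_mkcond /=.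
apply: ler_sum => w _; have ds0 : 0 <= ds w by [].
have h1 : m w * ds w <= L * y ^+ 4 * ds w by rewrite ler_wpM2r.
have h2 : m w * d w <= L * y ^+ 4 * d w by rewrite ler_wpM2r.
have h3 : 0 <= L * y ^+ 4 * ds w by rewrite mulr_ge0 // mulr_ge0 // ltW.
case: (w \in W) => /=; lra.
Qed.

End DenseIsSampled.

(** * The union bound *)

(* The Chernoff exponent, with [q = sqrt n], [lam = lam0 / q], [T] the total weight
   and [E] the lower-order loss in the weight of [H]. *)
Lemma exponent_arith (R : realFieldType) (p beta sigma L eta delta lam0 lam q T l E b : R) :
  0 < p -> p < 1 -> 0 <= beta -> beta <= 1 -> sigma = beta ^+ 2 - p -> 0 < sigma ->
  L * eta * 16 = sigma -> 128 * delta = sigma -> 64 * L * lam0 = sigma ->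
  4 * b = 4 * beta - sigma ->
  0 < q -> 0 < lam0 -> lam * q = lam0 ->
  L * l * 32 <= sigma * q -> L * E * 16 <= sigma * q ^+ 3 ->
  T <= q ^+ 2 * ((1 + 4 * delta) * q ^+ 2 + L * q * l) ->
  8 * (lam * (p * (1 + 2 * (lam * (2 * (L * q)))) * T -
         (b ^+ 2 * q ^+ 4 - L * q * (eta * q ^+ 3 + E)))) <= - (lam0 * sigma) * q ^+ 3.
Proof.
move=> p0 p1 be0 be1 sE s0 hL hd hl hb q0 l0 hlam hLl hE hT.
have s1 : sigma <= 1 by rewrite sE; nra.
have lamK : 2 * (lam * (2 * (L * q))) * 16 = sigma.
  by rewrite -hl -hlam; ring.
have qX j : 0 < q ^+ j by rewrite exprn_gt0.
have T1 : 16 * T <= (16 + sigma) * q ^+ 4.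
  have h1 : q ^+ 2 * (L * q * l) * 32 <= sigma * q ^+ 4.
    have -> : q ^+ 2 * (L * q * l) * 32 = q ^+ 3 * (L * l * 32) by ring.
    have -> : sigma * q ^+ 4 = q ^+ 3 * (sigma * q) by ring.
    by rewrite ler_pM2l.
  have h2 : q ^+ 2 * ((1 + 4 * delta) * q ^+ 2) * 32 = (32 + sigma) * q ^+ 4.
    by rewrite -hd; ring.
  by move: hT; rewrite mulrDr; lra.
have f0 : 0 <= p * (16 + sigma) by rewrite mulr_ge0 // ltW //; lra.
have pT : 256 * (p * (1 + 2 * (lam * (2 * (L * q)))) * T) <=
    p * (16 + sigma) ^+ 2 * q ^+ 4.
  have -> : 256 * (p * (1 + 2 * (lam * (2 * (L * q)))) * T) =
    p * (16 + 2 * (lam * (2 * (L * q))) * 16) * (16 * T) by ring.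
  rewrite lamK.
  have -> : p * (16 + sigma) ^+ 2 * q ^+ 4 = p * (16 + sigma) * ((16 + sigma) * q ^+ 4) by ring.
  by rewrite ler_wpM2l.
have pT2 : p * (16 + sigma) ^+ 2 <= 256 * p + 64 * sigma.
  have : p * (32 * sigma + sigma ^+ 2) <= 1 * (32 * sigma + sigma ^+ 2).
    by rewrite ler_wpM2r ?(ltW p1) // addr_ge0 ?sqr_ge0 // mulr_ge0 // ltW.
  have : sigma ^+ 2 <= sigma by rewrite expr2 ger_pMr.
  nra.
have b2 : 2 * beta ^+ 2 - sigma <= 2 * b ^+ 2.
  have : 16 * b ^+ 2 = (4 * beta - sigma) ^+ 2 by rewrite -hb; ring.
  have : beta * sigma <= sigma by rewrite ger_pMl.
  have := sqr_ge0 sigma; nra.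
have hE2 : L * q * (eta * q ^+ 3 + E) * 16 <= 2 * sigma * q ^+ 4.
  have -> : L * q * (eta * q ^+ 3 + E) * 16 = (L * eta * 16) * q ^+ 4 + q * (L * E * 16) by ring.
  have : q * (L * E * 16) <= q * (sigma * q ^+ 3) by rewrite ler_pM2l.
  have -> : q * (sigma * q ^+ 3) = sigma * q ^+ 4 by ring.
  by rewrite hL; lra.
(* The budget in units of [q ^+ 4]: the mean is at most [p + sigma / 4],
   [b ^+ 2 >= beta ^+ 2 - sigma / 2], and the losses are at most [sigma / 8]. Of the gap [sigma], an
   eighth survives. *)
have main : 8 * (p * (1 + 2 * (lam * (2 * (L * q)))) * T -
         (b ^+ 2 * q ^+ 4 - L * q * (eta * q ^+ 3 + E))) <= - sigma * q ^+ 4.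
  have h1 : p * (16 + sigma) ^+ 2 * q ^+ 4 <= (256 * p + 64 * sigma) * q ^+ 4.
    by rewrite ler_pM2r.
  have h2 : (2 * beta ^+ 2 - sigma) * q ^+ 4 <= 2 * b ^+ 2 * q ^+ 4 by rewrite ler_pM2r.
  have : beta ^+ 2 * q ^+ 4 = (sigma + p) * q ^+ 4 by congr (_ * _); rewrite sE; ring.
  lra.
have lam_gt0 : 0 < lam by rewrite -(pmulr_lgt0 _ q0) hlam.
have -> : - (lam0 * sigma) * q ^+ 3 = lam * (- sigma * q ^+ 4) by rewrite -hlam; ring.
by rewrite mulrCA ler_pM2l.
Qed.

(** Both sides are compared with [(1 + z) ^+ j.+1]. With [n = z ^+ 16] this crudely replaces [log n]
    by a multiple of [z]. *)
Lemma addX1_le_expR (R : realType) (z : R) (j : nat) :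
  0 <= z -> z ^+ j.+1 + 1 <= expR (j.+1%:R * z).
Proof.
move=> z0; rewrite expRM_natl.
apply: (@le_trans _ _ ((1 + z) ^+ j.+1)); last first.
  by rewrite lerXn2r ?nnegrE ?addr_ge0 ?expR_ge0 // expR_ge1Dx.
elim: j => [|j IHj]; first by rewrite !expr1 addrC.
rewrite exprS [leRHS]exprS; apply: (@le_trans _ _ ((1 + z) * (z ^+ j.+1 + 1))).
  have := exprn_ge0 j.+1 z0; nra.
by rewrite ler_wpM2l // addr_ge0.
Qed.

Lemma subr1X_lt_inv (R : realType) (rho x N : R) (l : nat) :
  0 <= rho -> rho <= 1 -> 0 <= N -> N < expR x -> x <= rho * l%:R ->
  N * (1 - rho) ^+ l < 1.
Proof.
move=> r0 r1 N0 Nx xl.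
have h : (1 - rho) ^+ l <= expR (- x).
  apply: (@le_trans _ _ (expR (- rho) ^+ l)).
    by rewrite lerXn2r ?nnegrE ?subr_ge0 ?expR_ge0 // expR_ge1Dx.
  by rewrite -expRM_natl ler_expR mulrN lerN2 mulrC.
apply: (@le_lt_trans _ _ (N * expR (- x))); first by rewrite ler_wpM2l.
by rewrite expRN ltr_pdivrMr ?expR_gt0 // mul1r.
Qed.

(* Everything is a power of [z = n^(1/16)]: the sample has density [1 / k] with
   [k ~ z^4], it meets at most [M ~ 2 z^22] edges, and the fingerprints have size
   [l ~ 16 z^5 / kappa], all against the main term [z^24 = n^(3/2)]. *)
Lemma Gnp_fail_le (R : realType) (p c sigma L eta delta lam0 kappa z : R) (n : nat) :
  0 < p -> p < 1 -> 0 <= 1 - 2 * c -> 1 - 2 * c <= 1 ->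
  sigma = (1 - 2 * c) ^+ 2 - p -> 0 < sigma ->
  L * sigma = 8 -> L * eta * 16 = sigma -> 128 * delta = sigma ->
  64 * L * lam0 = sigma -> 8 * kappa = eta ^+ 2 * delta ->
  1 <= z -> z ^+ 16 = n%:R -> 6 <= delta ^+ 2 * z ->
  L * (16 / kappa + 1) * 32 <= sigma * z ->
  L * (6 / (delta ^+ 2 * eta) + 2) * 16 <= sigma * z ->
  Gnp_prob p (fun G : sgraph n => ~~ C4_free_subgraphs_bounded c G) <=
  expR (32 * (16 / kappa + 5) * z ^+ 23 - lam0 * sigma / 8 * z ^+ 24).
Proof.
move=> p0 p1 be0 be1 sE s0 Ls Le hd hl hk z1 zn c1 c2 c3.
set beta := 1 - 2 * c in be0 be1 sE.
have s1 : sigma <= 1 by rewrite sE; nra.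
have L0 : 0 < L by rewrite -(pmulr_lgt0 _ s0) Ls.
have eta0 : 0 < eta by rewrite -(pmulr_rgt0 _ L0) -(@pmulr_lgt0 _ 16) // Le.
have delta0 : 0 < delta by lra.
have lam00 : 0 < lam0 by rewrite -(@pmulr_rgt0 _ (64 * L)) ?hl // mulr_gt0.
have kap0 : 0 < kappa.
  by rewrite -(@pmulr_rgt0 _ 8) ?hk // mulr_gt0 // exprn_gt0.
have eta1 : eta <= 1.
  have : eta * 128 = sigma ^+ 2 by rewrite expr2 -{1}Le -(mulrC sigma) ; nra.
  have : sigma ^+ 2 <= 1 by rewrite expr_le1 // ltW.
  lra.
have z0 : 0 < z by lra.
have zX j : 0 < z ^+ j by rewrite exprn_gt0.
have zX1 j : 1 <= z ^+ j by rewrite exprn_ege1.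
pose k := (Num.truncn (z ^+ 4)).+1.
pose l := (Num.truncn (16 / kappa * z ^+ 5)).+1.
pose M := (Num.truncn (2 * z ^+ 22)).+1.
have truncn_bounds (x : R) : 0 <= x -> x <= (Num.truncn x).+1%:R <= x + 1.
  move=> x0; have /andP[h1 h2] := truncn_itv x0.
  by rewrite ltW //= -natr1 lerD2r.
have /andP[kz kz2] : z ^+ 4 <= k%:R <= z ^+ 4 + 1 by apply: truncn_bounds; rewrite ltW.
have /andP[lz lz2] : 16 / kappa * z ^+ 5 <= l%:R <= 16 / kappa * z ^+ 5 + 1.
  by apply: truncn_bounds; rewrite mulr_ge0 ?divr_ge0 // ltW.
have /andP[Mz Mz2] : 2 * z ^+ 22 <= M%:R <= 2 * z ^+ 22 + 1.
  by apply: truncn_bounds; rewrite mulr_ge0 // ltW.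
have k0 : 0 < k%:R :> R by rewrite (lt_le_trans (zX 4)).
have kz4 : k%:R <= 2 * z ^+ 4 by have := zX1 4; lra.
have lz5 : l%:R <= (16 / kappa + 1) * z ^+ 5 by have := zX1 5; lra.
pose rho := eta ^+ 2 * delta / (4 * k%:R).
have rhoE : rho * k%:R = 2 * kappa.
  by rewrite /rho -hk; field; exact: lt0r_neq0.
have rho0 : 0 < rho by rewrite -(pmulr_lgt0 _ k0) rhoE mulr_gt0.
have rho1 : rho <= 1.
  rewrite -(ler_pM2r k0) rhoE mul1r.
  have e2 : eta ^+ 2 <= 1 by rewrite expr_le1 // ltW.
  have d1 : delta <= 1 by lra.
  have : eta ^+ 2 * delta <= 1 * 1 by rewrite ler_pM ?sqr_ge0 ?(ltW delta0).
  have := zX1 4; lra.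
(* As [n = z ^+ 16 < expR (16 * z)], this makes fingerprints of length [l] sufficient. *)
have rhol : 16 * z <= rho * l%:R.
  rewrite -(ler_pM2r k0) [leRHS]mulrAC rhoE.
  have : 2 * (16 * z ^+ 5) <= 2 * kappa * l%:R.
    have -> : 2 * (16 * z ^+ 5) = 2 * kappa * (16 / kappa * z ^+ 5).
      by field; exact: lt0r_neq0.
    by rewrite ler_pM2l // mulr_gt0.
  apply: le_trans.
  have -> : 2 * (16 * z ^+ 5) = 16 * z * (2 * z ^+ 4) by ring.
  by rewrite ler_pM2l // mulr_gt0.
have n_exp : n.+1%:R <= expR (32 * z) :> R.
  rewrite -natr1 -zn; apply: le_trans (addX1_le_expR 31 (ltW z0)).
  by rewrite lerD2r ler_weXn2l.
have n2_exp : (n ^ 2).+1%:R <= expR (32 * z) :> R.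
  rewrite -natr1 natrX -zn -exprM; exact: addX1_le_expR (ltW z0).
have l_large : n%:R * (1 - rho) ^+ l < 1.
  apply: (subr1X_lt_inv (ltW rho0) rho1 _ _ rhol) => //.
  have := addX1_le_expR 15 (ltW z0); rewrite zn; lra.
pose B := L * (z ^+ 2) ^+ 4.
pose theta := (1 + 4 * delta) * (z ^+ 2) ^+ 8.
pose t := (beta - 2 / L) ^+ 2 * (z ^+ 2) ^+ 16 -
  L * (z ^+ 2) ^+ 4 * (eta * (z ^+ 2) ^+ 12 +
    6 * (z ^+ 2) ^+ 10 / (delta ^+ 2 * eta) + 2 * (z ^+ 2) ^+ 11).
have B0 : 0 < B by rewrite mulr_gt0 // !exprn_gt0.
have theta0 : 0 <= theta.
  by rewrite mulr_ge0 ?exprn_ge0 ?(ltW z0) //; lra.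
have [I [om [cardI om0 omT omH]]] :=
  weight_family M t (ltW B0) theta0 rho1 l_large.
have L2 : 2 / L = sigma / 4 by rewrite -(mulKf (lt0r_neq0 L0) sigma) Ls; field; exact: lt0r_neq0.
(* A violating [H] has degree sum above [beta * n^(3/2)], hence large weight; weights are
   nonnegative, so [G] weighs at least as much. *)
have fail_cover (G : sgraph n) : ~~ C4_free_subgraphs_bounded c G ->
    exists i, t <= \sum_(e in edges G) om i e.
  move=> /forallPn[H]; rewrite negb_imply -ltNge => /andP[/andP[HG H_free] Hbig].
  have dense : beta * (z ^+ 2) ^+ 12 <= \sum_(v < n) #|nbhd H v|%:R.
    rewrite -natr_sum handshake natrM; move: Hbig.
    have -> : n%:R `^ (3 / 2) = z ^+ 24.
      have -> : z ^+ 24 = (z ^+ 16) `^ (3 / 2); last by rewrite zn.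
      rewrite -!powR_mulrn ?(ltW z0) // -powRrM; congr (_ `^ _); by field.
    by rewrite -exprM /beta; lra.
  have [||||||||S [W sam]] := @dense_sampled R n k M H (z ^+ 2) beta L eta delta
    _ _ _ _ delta0 _ eta0 L0 _ _ _ H_free dense.
  - exact: zX1.
  - by rewrite -exprM.
  - by rewrite -exprM.
  - by rewrite -exprM.
  - lra.
  - rewrite L2; nra.
  - apply: (le_trans c1); rewrite ler_wpM2l ?sqr_ge0 // -exprM.
    by rewrite -[leLHS]expr1 ler_weXn2l.
  - by rewrite -exprM.
  have [i ti] := omH H S W H_free sam.
  exists i; apply: (le_trans ti).
  rewrite [leRHS]big_mkcond [leLHS]big_mkcond; apply: ler_sum => e _ /=.
  case: ifPn => [/(fintype.subsetP HG) ->//|_]; case: ifPn => // eG.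
  by have /andP[] := om0 i e (fintype.subsetP (edges_pairs G) e eG).
apply: (le_trans (Gnp_prob_union (ltW p0) (ltW p1) fail_cover)).
pose lam := lam0 / z ^+ 8.
have lamz : lam * z ^+ 8 = lam0 by rewrite divfK // lt0r_neq0.
have lam_gt0 : 0 < lam by rewrite divr_gt0.
have lamB : 64 * (lam * (2 * B)) = 2 * sigma.
  by rewrite /B -hl -lamz; ring.
have one i : Gnp_prob p (fun G : sgraph n => t <= \sum_(e in edges G) om i e) <=
    expR (- (lam0 * sigma / 8 * z ^+ 24)).
  apply: (le_trans (Gnp_prob_chernoff (ltW p0) (ltW p1) _ (om0 i) lam_gt0 _)).
    lra.
  rewrite ler_expR.
  pose E := 6 * (z ^+ 2) ^+ 10 / (delta ^+ 2 * eta) + 2 * (z ^+ 2) ^+ 11.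
  have b4 : 4 * (beta - 2 / L) = 4 * beta - sigma by rewrite L2; field.
  have Lq : L * z ^+ 8 = B by rewrite /B -exprM.
  have tE : t = (beta - 2 / L) ^+ 2 * (z ^+ 8) ^+ 4 -
      L * z ^+ 8 * (eta * (z ^+ 8) ^+ 3 + E).
    by rewrite /t /E -!exprM addrA.
  have lq : L * l%:R * 32 <= sigma * z ^+ 8.
    have h1 : L * l%:R * 32 <= (L * (16 / kappa + 1) * 32) * z ^+ 5.
      rewrite (_ : _ * z ^+ 5 = L * ((16 / kappa + 1) * z ^+ 5) * 32); last by ring.
      by rewrite ler_pM2r // ler_pM2l.
    apply: (le_trans h1); apply: (@le_trans _ _ (sigma * z * z ^+ 5)).
      by rewrite ler_pM2r.
    rewrite -mulrA ler_pM2l // -exprS ler_weXn2l //.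
  have Eq : L * E * 16 <= sigma * (z ^+ 8) ^+ 3.
    have c0 : 0 <= 6 / (delta ^+ 2 * eta).
      by rewrite divr_ge0 // mulr_ge0 ?sqr_ge0 // ltW.
    have E22 : E <= (6 / (delta ^+ 2 * eta) + 2) * z ^+ 22.
      have -> : E = 6 / (delta ^+ 2 * eta) * z ^+ 20 + 2 * z ^+ 22.
        by rewrite /E -!exprM; ring.
      by rewrite [leRHS]mulrDl lerD2r ler_wpM2l // ler_weXn2l.
    have h1 : L * E * 16 <= (L * (6 / (delta ^+ 2 * eta) + 2) * 16) * z ^+ 22.
      rewrite (_ : _ * z ^+ 22 = L * ((6 / (delta ^+ 2 * eta) + 2) * z ^+ 22) * 16); last by ring.
      by rewrite ler_pM2r // ler_pM2l.
    apply: (le_trans h1); apply: (@le_trans _ _ (sigma * z * z ^+ 22)).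
      by rewrite ler_pM2r.
    by rewrite -mulrA ler_pM2l // -exprS -exprM ler_weXn2l.
  have T_le : \sum_(e in pairs n) om i e <=
      (z ^+ 8) ^+ 2 * ((1 + 4 * delta) * (z ^+ 8) ^+ 2 + L * z ^+ 8 * l%:R).
    apply: (le_trans (omT i)); rewrite -zn /theta /B -!exprM.
    exact: lexx.
  have := exponent_arith p0 p1 be0 be1 sE s0 Le hd hl b4 (zX 8) lam00 lamz lq Eq T_le.
  rewrite -tE Lq -exprM; lra.
apply: (@le_trans _ _ (\sum_(i : I) expR (- (lam0 * sigma / 8 * z ^+ 24)))).
  by apply: ler_sum => i _; exact: one.
rewrite sumr_const -[leLHS]mulr_natl expRD ler_wpM2r ?expR_ge0 //.
rewrite [#|_|]cardI !natrM !natrX.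
have expl (x : R) (j : nat) (y : R) : 0 <= x -> x <= expR y -> x ^+ j <= expR (j%:R * y).
  by move=> x0 xy; rewrite expRM_natl lerXn2r // nnegrE expR_ge0.
(* The three factors count revealed edges, degree sequences and fingerprints; their exponents are
   all [O(z ^+ 23)]. *)
apply: (@le_trans _ _ (expR (M%:R * (32 * z)) * expR (n%:R * (32 * z)) *
    expR (n%:R * (l%:R * (32 * z))))).
  rewrite ler_pM ?mulr_ge0 ?exprn_ge0 //; last by rewrite expl ?exprn_ge0 ?expl.
  by rewrite ler_pM ?exprn_ge0 ?expl.
rewrite -!expRD ler_expR.
have -> : M%:R * (32 * z) + n%:R * (32 * z) + n%:R * (l%:R * (32 * z)) =
    (M%:R + z ^+ 16 + z ^+ 16 * l%:R) * (32 * z) by rewrite -zn; ring.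
have -> : 32 * (16 / kappa + 5) * z ^+ 23 = (16 / kappa + 5) * z ^+ 22 * (32 * z).
  by rewrite (exprSr z 22); ring.
rewrite ler_pM2r ?mulr_gt0 //.
have h1 : z ^+ 16 * l%:R <= (16 / kappa + 1) * z ^+ 21.
  rewrite (_ : _ * z ^+ 21 = z ^+ 16 * ((16 / kappa + 1) * z ^+ 5)); last by ring.
  by rewrite ler_pM2l.
have kk : 0 <= 16 / kappa by rewrite divr_ge0 // ltW.
have h2 : (16 / kappa + 1) * z ^+ 21 <= (16 / kappa + 1) * z ^+ 22.
  by rewrite ler_wpM2l ?addr_ge0 // ler_weXn2l.
have h3 : z ^+ 16 <= z ^+ 22 by rewrite ler_weXn2l.
have := zX1 22; lra.
Qed.

Local Open Scope classical_set_scope.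

(** The condition [p < (1 - 2 * c) ^+ 2] says that [1 / 2 - c] exceeds [sqrt p / 2]; every parameter
    is then a function of the gap [sigma]. *)
Lemma Gnp_prob_C4_free_bounded (R : realType) (p c : R) :
  0 < p -> p < 1 -> 0 <= 1 - 2 * c -> 1 - 2 * c <= 1 -> p < (1 - 2 * c) ^+ 2 ->
  (fun n : nat => Gnp_prob p (@C4_free_subgraphs_bounded R c n)) @ \oo --> (1 : R).
Proof.
move=> p0 p1 be0 be1 pb.
pose sigma := (1 - 2 * c) ^+ 2 - p.
have s0 : 0 < sigma by rewrite subr_gt0.
have sn0 := lt0r_neq0 s0.
pose L := 8 / sigma; pose eta := sigma ^+ 2 / 128; pose delta := sigma / 128.
pose lam0 := sigma ^+ 2 / 512; pose kappa := eta ^+ 2 * delta / 8.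
pose A := 32 * (16 / kappa + 5); pose C := lam0 * sigma / 8.
have L0 : 0 < L by rewrite divr_gt0.
have eta0 : 0 < eta by rewrite divr_gt0 // exprn_gt0.
have delta0 : 0 < delta by rewrite divr_gt0.
have kappa0 : 0 < kappa by rewrite divr_gt0 // mulr_gt0 // exprn_gt0.
have C0 : 0 < C by rewrite divr_gt0 // mulr_gt0 // divr_gt0 // exprn_gt0.
have A0 : 0 < A by rewrite mulr_gt0 // addr_gt0 // divr_gt0.
apply/cvgrPdist_le => e e0.
pose c1 := 6 / delta ^+ 2.
pose c2 := L * (16 / kappa + 1) * 32 / sigma.
pose c3 := L * (6 / (delta ^+ 2 * eta) + 2) * 16 / sigma.
pose c4 := (A + 1) / C.
(* A sum of positive thresholds dominates each of them; [c4] makes the exponent at most [- z], and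
   [e^-1] yields [expR (- z) <= e]. *)
pose Z := 1 + c1 + c2 + c3 + c4 + e^-1.
have c10 : 0 < c1 by rewrite divr_gt0 // exprn_gt0.
have c20 : 0 < c2.
  have h : 0 < 16 / kappa + 1 by rewrite addr_gt0 // divr_gt0.
  by rewrite divr_gt0 // mulr_gt0 // mulr_gt0.
have c30 : 0 < c3.
  have h : 0 < delta ^+ 2 * eta by rewrite mulr_gt0 // exprn_gt0.
  have h2 : 0 < 6 / (delta ^+ 2 * eta) + 2 by rewrite addr_gt0 // divr_gt0.
  by rewrite divr_gt0 // mulr_gt0 // mulr_gt0.
have c40 : 0 < c4 by rewrite divr_gt0 // addr_gt0.
have ei0 : 0 < e^-1 by rewrite invr_gt0.
exists (Num.truncn (Z ^+ 16)).+1 => // n /= Zn.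
pose z : R := n%:R `^ (16^-1).
have zn : z ^+ 16 = n%:R.
  by rewrite -powR_mulrn ?powR_ge0 // -powRrM mulVf // powRr1.
have Zz : Z <= z.
  have Z0 : 0 <= Z by rewrite /Z; lra.
  rewrite leNgt; apply/negP => zZ.
  have : z ^+ 16 < Z ^+ 16 by rewrite ltrXn2r // powR_ge0.
  rewrite zn ltNge => /negP; apply.
  have := truncnS_gt (Z ^+ 16) => /ltW /le_trans; apply.
  by rewrite ler_nat.
rewrite Gnp_probC opprB addrC subrK ger0_norm; last first.
  by apply: Gnp_prob_ge0; rewrite ltW.
have z1 : 1 <= z by apply: le_trans Zz; rewrite /Z; lra.
have z0 : 0 < z by lra.
have zX j : 0 < z ^+ j by rewrite exprn_gt0.
apply: (le_trans (@Gnp_fail_le R p c sigma L eta delta lam0 kappa z n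
  p0 p1 be0 be1 erefl s0 _ _ _ _ _ z1 zn _ _ _)).
- by rewrite /L divfK.
- by rewrite /L /eta; field.
- by rewrite /delta; field.
- by rewrite /L /lam0; field.
- by rewrite /kappa; field.
- rewrite mulrC -ler_pdivrMr ?exprn_gt0 //; apply: le_trans Zz.
  by rewrite -/c1 /Z; lra.
- by rewrite -ler_pdivrMl // mulrC -/c2; apply: le_trans Zz; rewrite /Z; lra.
- by rewrite -ler_pdivrMl // mulrC -/c3; apply: le_trans Zz; rewrite /Z; lra.
rewrite -/A -/C.
have Cz : A + 1 <= C * z.
  by rewrite -ler_pdivrMl // mulrC -/c4; apply: le_trans Zz; rewrite /Z; lra.
apply: (@le_trans _ _ (expR (- z))).
  rewrite ler_expR (_ : A * z ^+ 23 - C * z ^+ 24 = z ^+ 23 * (A - C * z)); last first.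
    by rewrite (exprSr z 23); ring.
  apply: (@le_trans _ _ (z ^+ 23 * -1)); first by rewrite ler_pM2l //; lra.
  by rewrite mulrN1 lerN2 -[leLHS]expr1 ler_weXn2l.
rewrite expRN -[leRHS]invrK lef_pV2 ?posrE ?expR_gt0 //.
apply: (@le_trans _ _ z); first by apply: le_trans Zz; rewrite /Z; lra.
by apply: le_trans (expR_ge1Dx z); lra.
Qed.

Unset Implicit Arguments.

Theorem theorem1p1 (R : realType) :
  (forall p : R, 0 < p -> p < 1 ->
     exists c : R, 0 < c /\
       (fun n : nat => Gnp_prob p (@C4_free_subgraphs_bounded R c n))
         @ \oo --> (1 : R)) /\
  (fun n : nat =>
     Gnp_prob (1 / 2 : R) (@C4_free_subgraphs_bounded R (28 / 1000) n))
    @ \oo --> (1 : R).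
Proof.
(* For [p = 1 / 2] the condition reads [1 / 2 < (944 / 1000) ^+ 2]. *)
split=> [p p0 p1|]; last by apply: Gnp_prob_C4_free_bounded; lra.
(* Then [1 - 2 * c = (1 + p) / 2], whose square exceeds [p] by [((1 - p) / 2) ^+ 2]. *)
exists ((1 - p) / 4); split; first lra.
by apply: Gnp_prob_C4_free_bounded => //; [lra|lra|nra].
Qed.
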